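(* Let $H$ be a Hilbert space, let $C\subset H$ be nonempty, bounded, closed and convex, and let $F:C\times C\to C$ be a weakly nonexpansive operator. Then, for every $\lambda\in(0,1)$ and every $x_0\in C$, the sequence $\{x_n\}_{n\ge 0}$ defined by $$x_{n+1}=(1-\lambda)x_n+\lambda F(x_n,x_n),\quad n\ge 0,$$ converges weakly to a coupled fixed point of $F$, i.e. there exists $p\in C$ with $F(p,p)=p$ such that $x_n$ converges weakly to $p$.
   Context: A mapping $F:C\times C\to H$, with $C$ a subset of a normed linear space $H$, is called weakly nonexpansive if there are constants $a,b\ge 0$ with $a+b\le 1$ such that $\|F(x,y)-F(u,v)\|\le a\|x-u\|+b\|y-v\|$ for all $x,y,u,v\in C$. A pair $(x,y)\in C\times C$ is a coupled fixed point of $F$ if $F(x,y)=x$ and $F(y,x)=y$; a point $p\in C$ with $F(p,p)=p$ is identified with the coupled fixed point $(p,p)$ with equal components. *)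

(* Defs.v *)
(* MathComp / MathComp-Analysis *)
From HB Require Import structures.
From mathcomp Require Import all_boot all_order all_algebra sesquilinear.
From mathcomp Require Import complex.
From mathcomp Require Import all_classical all_reals all_analysis.
Import Order.TTheory GRing.Theory Num.Theory.
Import numFieldNormedType.Exports.

Set Implicit Arguments.
Unset Strict Implicit.
Unset Printing Implicit Defensive.

Local Open Scope classical_set_scope.
Local Open Scope ring_scope.

(* A Hilbert space may be real or complex: its scalar field is R or R[i].
   In the order of R[i], x <= y holds exactly when Im x = Im y and
   Re x <= Re y, so that 0 <= a, 0 < a < 1, etc. force a to be real. *)
Inductive scalar_kind : Set := RealScalars | ComplexScalars.

Definition scalar_field (R : realType) (k : scalar_kind) : numFieldType :=
  match k with
  | RealScalars => R
  | ComplexScalars => R[i]%C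
  end.

Definition scalar_conj (R : realType) (k : scalar_kind) :
    scalar_field R k -> scalar_field R k :=
  match k with
  | RealScalars => idfun
  | ComplexScalars => Num.conj
  end.

(* Together with completeness of H, this makes (H, dot) a Hilbert space.
   The form dot is linear on the left and theta-linear on the right. *)
Definition norm_from_dot (K : numFieldType) (H : normedModType K)
    (theta : K -> K) (dot : {dot H for theta}) : Prop :=
  forall x : H, `|x| ^+ 2 = dot x x.

Definition weakly_nonexpansive (K : numFieldType) (H : normedModType K)
    (C : set H) (F : H * H -> H) : Prop :=
  exists a b : K, [/\ 0 <= a, 0 <= b, a + b <= 1 &
    forall x y u v : H, C x -> C y -> C u -> C v ->
      `|F (x, y) - F (u, v)| <= a * `|x - u| + b * `|y - v|].

Definition coupled_fixed_point (H : Type) (C : set H) (F : H * H -> H)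
    (x y : H) : Prop :=
  [/\ C x, C y, F (x, y) = x & F (y, x) = y].

Definition weakly_cvg (K : numFieldType) (H : normedModType K)
    (x : nat -> H) (p : H) : Prop :=
  forall f : {linear H -> K^o}, continuous f -> f (x n) @[n --> \oo] --> f p.

(* Main.v *)
(* H is regarded as a real Hilbert space for the inner product Re <x, y>, and
   T z = F (z, z) is nonexpansive on C. For a positive normalised functional L
   on bounded real sequences ("mean") and a bounded sequence x, the Riesz theorem
   gives a centre p with L <x_n, z> = <p, z>, hence
     L |x_n - z|^2 = L |x_n - p|^2 + |z - p|^2  for all z;
   p lies in C when x does, by projection onto C.
   - For an orbit of T and a shift-invariant mean (a limit of Cesaro averages
     along an ultrafilter), L |x_n - T p|^2 <= L |x_n - p|^2, so T p = p.
   - For the iteration x_(n+1) = (1 - lambda) x_n + lambda T x_n, the distances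
     to fixed points decrease and x_n - T x_n -> 0. Taking for L the limit along
     an ultrafilter finer than \oo, the centre is again a fixed point, and it
     does not depend on the ultrafilter because |x_n - p| converges for every
     fixed point p. So all ultrafilter weak limits of x_n agree, which is weak
     convergence. *)

Require Import Defs.
From HB Require Import structures.
From mathcomp Require Import all_boot all_order all_algebra sesquilinear.
From mathcomp Require Import all_classical all_reals all_analysis.
From mathcomp Require Import complex ring lra.
Import Order.TTheory GRing.Theory Num.Theory.
Import numFieldNormedType.Exports.

Local Open Scope classical_set_scope.
Local Open Scope ring_scope.

(** * Real Hilbert spaces *)

(** Completeness is phrased through [ip] alone, so [V] needs no norm or topology. *)
Record real_hilbert {R : realType} {V : lmodType R} (ip : V -> V -> R) : Prop :=
  RealHilbert {
  ipC : forall x y, ip x y = ip y x;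
  ipDl : forall x y z, ip (x + y) z = ip x z + ip y z;
  ipZl : forall a x z, ip (a *: x) z = a * ip x z;
  ip_ge0 : forall x, 0 <= ip x x;
  ip_eq0 : forall x, ip x x = 0 -> x = 0;
  ip_complete : forall u : nat -> V,
    (forall e, 0 < e -> exists N, forall m n, (N <= m)%N -> (N <= n)%N ->
       ip (u m - u n) (u m - u n) < e) ->
    exists p, (fun n => ip (u n - p) (u n - p)) @ \oo --> (0 : R) }.

Arguments ipC {R V ip}.
Arguments ipDl {R V ip}.
Arguments ipZl {R V ip}.
Arguments ip_ge0 {R V ip}.
Arguments ip_eq0 {R V ip}.
Arguments ip_complete {R V ip}.

Section RealHilbert.
Local Set Implicit Arguments.
Local Unset Strict Implicit.
Context {R : realType} {V : lmodType R} {ip : V -> V -> R}.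
Hypothesis ipH : real_hilbert ip.

Local Notation q x := (ip x x).

Definition sq_cvg (u : nat -> V) (p : V) :=
  (fun n => ip (u n - p) (u n - p)) @ \oo --> (0 : R).

Definition sq_closed (D : set V) :=
  forall u p, (forall n, D (u n)) -> sq_cvg u p -> D p.

Definition segment_closed (D : set V) :=
  forall t u v, 0 <= t <= 1 -> D u -> D v -> D ((1 - t) *: u + t *: v).

(* For linear l this is equivalent to continuity, by homogeneity. *)
Definition bounded_form (l : V -> R) := exists M, forall z, l z <= M + q z.

Lemma ipDr x y z : ip z (x + y) = ip z x + ip z y.
Proof. by rewrite !(ipC ipH z) (ipDl ipH). Qed.

Lemma ipZr a x z : ip z (a *: x) = a * ip z x.
Proof. by rewrite !(ipC ipH z) (ipZl ipH). Qed.

Lemma ipNl x z : ip (- x) z = - ip x z.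
Proof. by rewrite -scaleN1r (ipZl ipH) mulN1r. Qed.

Lemma ipNr x z : ip z (- x) = - ip z x.
Proof. by rewrite -scaleN1r ipZr mulN1r. Qed.

Lemma ip0l z : ip 0 z = 0.
Proof. by rewrite -(scale0r (0 : V)) (ipZl ipH) mul0r. Qed.

Definition ipE := (ipDl ipH, ipDr, ipZl ipH, ipZr, ipNl, ipNr).

(** Stands in for Cauchy-Schwarz; the additive form avoids square roots. *)
Lemma ip_le x y : 2 * ip x y <= q x + q y.
Proof.
by have := ip_ge0 ipH (x - y); rewrite !ipE (ipC ipH y x); lra.
Qed.

Lemma ip_ge x y : - (q x + q y) <= 2 * ip x y.
Proof. by have := ip_le x (- y); rewrite !ipE; lra. Qed.

Lemma bounded_form_ip x : bounded_form (ip x).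
Proof.
exists (q x) => z; have := ip_le x z.
by have := ip_ge0 ipH x; have := ip_ge0 ipH z; lra.
Qed.

Lemma scalar_ip x : scalar (ip x).
Proof. by move=> k u v; rewrite !ipE. Qed.

Section Form.
Context {l : V -> R}.
Hypotheses (sl : scalar l) (bl : bounded_form l).

Lemma form0 : l 0 = 0.
Proof. by have := sl 1 0 0; rewrite scaler0 addr0; lra. Qed.

Lemma formD x y : l (x + y) = l x + l y.
Proof. by rewrite -[x]scale1r sl scale1r mul1r. Qed.

Lemma formZ k x : l (k *: x) = k * l x.
Proof. by rewrite -[k *: x]addr0 sl form0 addr0. Qed.

Lemma formN x : l (- x) = - l x.
Proof. by rewrite -scaleN1r formZ mulN1r. Qed.

(** Scaling the argument by [k] turns the bound on [l] into [|l x| <= M / k + k * q x]; a large [k]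
    is fixed first, then [n] is taken large. *)
Lemma form_cvg u p : sq_cvg u p -> l (u n) @[n --> \oo] --> l p.
Proof.
case: bl => M hM up.
have hk k x : 0 < k -> `|l x| <= M / k + k * q x.
  move=> k0.
  have h y : l y <= M / k + k * q y.
    have := hM (k *: y); rewrite formZ !ipE => h.
    rewrite -(ler_pM2l k0); apply: (le_trans h).
    by rewrite le_eqVlt; apply/orP; left; apply/eqP; field; rewrite gt_eqF.
  by rewrite ler_norml h andbT lerNl -formN (le_trans (h _))// !ipE; lra.
have M0 : 0 <= M by have := hM 0; rewrite form0 ip0l; lra.
apply/cvgrPdist_lt => e e0.
(* Using [M + 1] keeps [k] positive when [M = 0] and still gives [M / k < e / 2]. *)
pose k := 2 * (M + 1) / e.
have k0 : 0 < k by rewrite /k divr_gt0 ?mulr_gt0//; lra.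
have ek : 0 < e / (2 * k) by rewrite divr_gt0// mulr_gt0.
move/cvgrPdist_lt : up => /(_ _ ek); apply: filterS => n.
rewrite sub0r normrN ger0_norm ?(ip_ge0 ipH)// => hn.
rewrite distrC -formN -formD; apply: (le_lt_trans (hk k _ k0)).
have -> : M / k = e / 2 * (M / (M + 1)).
  by rewrite /k; field; rewrite !gt_eqF//; lra.
have : M / (M + 1) < 1 by rewrite ltr_pdivrMr; lra.
have : k * ip (u n - p) (u n - p) < e / 2.
  by rewrite mulrC -ltr_pdivlMr// -mulrA -invfM.
by nra.
Qed.

End Form.

Lemma sq_cvg_q u p : sq_cvg u p -> q (u n) @[n --> \oo] --> q p.
Proof.
move=> up; have hl := form_cvg (scalar_ip p) (bounded_form_ip p) up.
have -> : q p = 0 + (2 * q p - q p) by lra.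
have -> : (fun n => q (u n)) =
    (fun n => ip (u n - p) (u n - p) + (2 * ip p (u n) - q p)).
  by apply/funext => n; rewrite !ipE (ipC ipH (u n) p); lra.
apply: cvgD => //; apply: cvgB; last exact: cvg_cst.
by apply: cvgM hl; exact: cvg_cst.
Qed.

(* Stampacchia: the minimiser of q z - 2 l z over D. *)
Lemma variational_inequality (D : set V) (l : V -> R) :
  D !=set0 -> sq_closed D -> segment_closed D -> scalar l -> bounded_form l ->
  exists2 p, D p & forall z, D z -> l (z - p) <= ip p (z - p).
Proof.
move=> [d0 Dd0] clD cvD sl bl.
pose phi z := q z - 2 * l z.
have [M hM] := bl.
(* At half of [z] the bound on [l] amounts to [2 * l z <= 4 * M + q z]. *)
have lb z : - (4 * M) <= phi z.
  have := hM (2^-1 *: z); rewrite (formZ sl) !ipE /phi.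
  by have := ip_ge0 ipH z; lra.
pose m := inf (phi @` D).
have hinf : has_inf (phi @` D).
  by split; [exists (phi d0), d0|exists (- (4 * M)) => _ [z _ <-]].
have mle z : D z -> m <= phi z.
  by move=> Dz; apply: ge_inf; [case: hinf|exists z].
have /choice[u hu] : forall n, exists z, D z /\ phi z < m + n.+1%:R^-1.
  move=> n; have [|_ [z Dz <-] hz] := @inf_adherent _ _ n.+1%:R^-1 _ hinf.
    by rewrite invr_gt0.
  by exists z.
(* Parallelogram law, with [phi >= m] at the midpoint; it makes the minimising sequence [u]
   Cauchy. *)
have mid x y : D x -> D y -> ip (x - y) (x - y) <= 2 * phi x + 2 * phi y - 4 * m.
  move=> Dx Dy; have half : 0 <= (2^-1 : R) <= 1.
    apply/andP; split; lra.
  have := mle _ (cvD _ _ _ half Dx Dy).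
  rewrite /phi (formD sl) !(formZ sl) !ipE (ipC ipH y x); lra.
have [e e0|p up] := ip_complete ipH u.
  have [N hN] : exists N, forall n, (N <= n)%N -> n.+1%:R^-1 < e / 4.
    have e4 : 0 < e / 4 by lra.
    have /cvgrPdist_lt/(_ _ e4)[N _ hN] := @cvg_harmonic R.
    exists N => n Nn; have := hN n Nn; rewrite /= sub0r normrN.
    by rewrite ger0_norm ?invr_ge0.
  exists N => i j Ni Nj; apply: (le_lt_trans (mid _ _ (hu i).1 (hu j).1)).
  have [_ hi] := hu i; have [_ hj] := hu j.
  move: hi hj (hN i Ni) (hN j Nj); move: (i.+1%:R^-1) (j.+1%:R^-1) => a b.
  by move: (phi (u i)) (phi (u j)) => fi fj; lra.
have Dp : D p by apply: clD up => n; case: (hu n).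
have pm : phi p <= m.
  have h1 : phi (u n) @[n --> \oo] --> phi p.
    apply: cvgB; first exact: sq_cvg_q.
    by apply: cvgM; [exact: cvg_cst|exact: form_cvg].
  have h2 : m + n.+1%:R^-1 @[n --> \oo] --> m + 0.
    by apply: cvgD; [exact: cvg_cst|exact: cvg_harmonic].
  rewrite -(addr0 m); apply: (ler_cvg_to h1 h2).
  by apply: nearW => n; exact/ltW/(hu n).2.
exists p => // z Dz; rewrite leNgt; apply/negP => hlt.
have segE t : (1 - t) *: p + t *: z = p + t *: (z - p).
  by rewrite scalerBr scalerBl scale1r addrAC addrA.
move: (z - p) segE hlt => w segE hlt.
pose d := l w - ip p w.
have dpos : 0 < d by rewrite /d; lra.
have qw := ip_ge0 ipH w.
(* Moving from [p] to [p + t *: w] changes [phi] by [t * (t * q w - 2 * d)]. This [t] satisfies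
   [t * q w <= d], so [phi] would drop below [m]. *)
pose t := d / (d + q w).
have t01 : 0 <= t <= 1.
  by rewrite divr_ge0 ?ler_pdivrMr ?mul1r; lra.
have := mle _ (cvD _ _ _ t01 Dp Dz).
rewrite segE.
have tq : t * q w <= d.
  by rewrite /t mulrAC ler_pdivrMr; nra.
have t0 : 0 < t by rewrite divr_gt0; lra.
move: pm; rewrite /phi (formD sl) (formZ sl) !ipE (ipC ipH w p).
have -> : l w = ip p w + d by rewrite /d; lra.
by nra.
Qed.

(** On the whole space the variational inequality may be tested at [z + p] and at [- z + p], which
    yields both inequalities. *)
Lemma riesz_representation (l : V -> R) : scalar l -> bounded_form l ->
  exists p, forall z, l z = ip p z.
Proof.
move=> sl bl; have [|||p _ hp] := @variational_inequality setT l _ _ _ sl bl.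
- by exists 0.
- by [].
- by [].
exists p => z; apply/le_anti/andP; split.
  by have := hp (z + p) I; rewrite addrK.
by have := hp (- z + p) I; rewrite addrK (formN sl) ipNr lerN2.
Qed.

End RealHilbert.

(** * Means and ultrafilter limits *)

Definition bounded_seq {R : realType} (a : nat -> R) :=
  exists M, forall n, `|a n| <= M.

(** [L] is a total function, but linearity and monotonicity are asked only on bounded sequences,
    where ultrafilter limits exist. *)
Record is_mean {R : realType} (L : (nat -> R) -> R) : Prop := IsMean {
  mean_cst : forall c, L (fun=> c) = c;
  mean_lin : forall k (a b : nat -> R), bounded_seq a -> bounded_seq b ->
    L (fun n => a n + k * b n) = L a + k * L b;
  mean_le : forall (a b : nat -> R), bounded_seq a -> bounded_seq b ->
    (forall n, a n <= b n) -> L a <= L b }.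

Section UltraMean.
Context {R : realType}.
Local Set Implicit Arguments.
Local Unset Strict Implicit.
Implicit Types (a b : nat -> R) (U : set_system nat).

Lemma bounded_seqB a b : bounded_seq a -> bounded_seq b ->
  bounded_seq (fun n => a n - b n).
Proof.
move=> [M hM] [N hN]; exists (M + N) => n.
by rewrite (le_trans (ler_normB _ _))// lerD.
Qed.

(** By compactness of [[-M, M]] the image filter has a cluster point, and an ultrafilter converges
    to its cluster points. *)
Lemma ultra_cvg U a : UltraFilter U -> bounded_seq a -> cvg (a n @[n --> U]).
Proof.
move=> UU [M hM].
have [|c [_ hc]] := @segment_compact R (- M) M (a n @[n --> U]) _.
  by apply: nearW => n; rewrite /= in_itv/= -ler_norml.
apply/cvg_ex; exists c => B Bc.
have [//|nB] := in_ultra_setVsetC (a @^-1` B) UU.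
have [x [nBx Bx]] := hc (~` B) B nB Bc.
by case: nBx.
Qed.

Lemma ultra_mean U : UltraFilter U ->
  is_mean (fun a => lim (a n @[n --> U])).
Proof.
move=> UU; split.
- by move=> c; exact: lim_cst.
- move=> k a b /(ultra_cvg UU) ha /(ultra_cvg UU) hb.
  apply: cvg_lim => //; apply: cvgD => //; apply: cvgM => //; exact: cvg_cst.
- move=> a b /(ultra_cvg UU) ha /(ultra_cvg UU) hb hab.
  by apply: ler_lim => //; exact: nearW.
Qed.

(** If [a n] were not eventually in a neighbourhood [B] of [c], then [\oo] restricted to the indices
    outside would be proper, and an ultrafilter above it would contradict the hypothesis. *)
Lemma cvg_ultra a (c : R) :
  (forall U, UltraFilter U -> \oo `<=` U -> a n @[n --> U] --> c) ->
  a n @[n --> \oo] --> c.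
Proof.
move=> h B Bc; apply: contrapT => nB.
have F : ProperFilter (within (~` (a @^-1` B)) \oo).
  apply: Build_ProperFilter_ex => A hA.
  have {}hA : \oo (fun n => (~` (a @^-1` B)) n -> A n) := hA.
  apply: contrapT => nA; apply: nB; apply: (filterS _ hA) => n hn.
  by apply: contrapT => /hn An; apply: nA; exists n.
have [U [UU FU]] := ultraFilterLemma F.
have ooU : \oo `<=` U by move=> A hA; apply: FU; exact: (cvg_within _ hA).
have h1 : U (a @^-1` B) := h U UU ooU B Bc.
have h2 : U (~` (a @^-1` B)) by apply: FU; exact: withinT.
by have [n []] := filter_ex (filterI h1 h2).
Qed.

(** * Cesaro averages and a shift-invariant mean *)

Definition cesaro a n := (\sum_(i < n.+1) a i) / n.+1%:R.

Lemma cesaro_bounded a : bounded_seq a -> bounded_seq (cesaro a).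
Proof.
move=> [M hM]; exists M => n; rewrite /cesaro normrM normfV normr_nat.
rewrite ler_pdivrMr ?ltr0n//; apply: (le_trans (ler_norm_sum _ _ _)).
rewrite mulr_natr -[X in _ *+ X](card_ord n.+1) -sumr_const.
by apply: ler_sum => i _.
Qed.

Lemma shift_invariant_mean : exists2 L : (nat -> R) -> R, is_mean L &
  forall a, bounded_seq a -> L (fun n => a n.+1) = L a.
Proof.
have [U [UU ooU]] := @ultraFilterLemma _ (\oo : set_system nat) _.
have uM := ultra_mean UU.
exists (fun a => lim (cesaro a n @[n --> U])).
  split.
  - move=> c; have -> : cesaro (fun=> c) = fun=> c; last exact: (mean_cst _ uM).
    apply/funext => n; rewrite /cesaro sumr_const card_ord -[c *+ _]mulr_natr.
    by rewrite mulfK ?pnatr_eq0.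
  - move=> k a b /cesaro_bounded ha /cesaro_bounded hb.
    have -> : cesaro (fun n => a n + k * b n) =
        fun n => cesaro a n + k * cesaro b n; last exact: (mean_lin _ uM).
    apply/funext => n; by rewrite /cesaro big_split/= -mulr_sumr mulrDl mulrA.
  - move=> a b ha hb hab; apply: (mean_le _ uM) => [||n];
      [exact: cesaro_bounded..|].
    by rewrite ler_pM2r ?invr_gt0// ler_sum.
move=> a ba.
have bs : bounded_seq (fun n => a n.+1) by case: ba => M hM; exists M.
apply/eqP; rewrite -subr_eq0 -mulN1r -(mean_lin _ uM); [|exact: cesaro_bounded..].
apply/eqP; apply: cvg_lim => //.
(* The two sums of [n.+1] terms telescope, leaving a bounded numerator over [n.+1]. *)
have -> : (fun n => cesaro (fun n => a n.+1) n + -1 * cesaro a n) =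
    (fun n => (a n.+1 - a 0%N) * n.+1%:R^-1).
  apply/funext => n; rewrite mulN1r /cesaro -mulrBl; congr (_ * _).
  rewrite big_ord_recr [X in _ - X]big_ord_recl/=.
  by under [X in _ - (_ + X)]eq_bigr do rewrite /bump/=; ring.
suff : (fun n => (a n.+1 - a 0%N) * n.+1%:R^-1) @ \oo --> (0 : R).
  by move=> h A hA; apply: ooU; exact: h.
have [M hM] := ba.
apply: norm_cvg0; apply: (@squeeze_cvgr _ _ _ _ (fun=> 0) (fun n => 2 * M * n.+1%:R^-1)).
- apply: nearW => n; rewrite normr_ge0/= normrM ler_pM// ?normfV ?normr_nat//.
  by rewrite (le_trans (ler_normB _ _))// mulrDl mul1r lerD.
- exact: cvg_cst.
- by rewrite -[X in _ --> X](mulr0 (2 * M)); apply: cvgM;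
    [exact: cvg_cst|exact: cvg_harmonic].
Qed.

End UltraMean.

(** * Weak centres of bounded sequences *)

Section Center.
Context {R : realType} {V : lmodType R} {ip : V -> V -> R}.
Hypothesis ipH : real_hilbert ip.
Local Set Implicit Arguments.
Local Unset Strict Implicit.
Local Notation q x := (ip x x).

Definition sq_bounded (x : nat -> V) := exists M, forall n, q (x n) <= M.

(** For an ultrafilter limit this is the weak limit of [x] along it; for a Cesaro mean it is a weak
    ergodic limit. *)
Definition weak_center (L : (nat -> R) -> R) (x : nat -> V) (p : V) :=
  forall z, L (fun n => ip (x n) z) = ip p z.

Lemma sq_bounded_ip x z : sq_bounded x -> bounded_seq (fun n => ip (x n) z).
Proof.
move=> [M hM]; exists (M + q z) => n.
have := ip_le ipH (x n) z; have := ip_ge ipH (x n) z; have := hM n.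
have := ip_ge0 ipH (x n); have := ip_ge0 ipH z.
by rewrite ler_norml => *; apply/andP; split; lra.
Qed.

Lemma sq_bounded_dist x z : sq_bounded x ->
  bounded_seq (fun n => q (x n - z)).
Proof.
move=> [M hM]; exists (2 * M + 2 * q z) => n; rewrite ger0_norm ?(ip_ge0 ipH)//.
have := ip_ge0 ipH (x n + z); rewrite !(ipE ipH) (ipC ipH z).
by have := hM n; lra.
Qed.

Section Mean.
Context {L : (nat -> R) -> R} {x : nat -> V}.
Hypotheses (mL : is_mean L) (bx : sq_bounded x).

Lemma weak_center_exists : exists p, weak_center L x p.
Proof.
apply: (@riesz_representation _ _ _ ipH (fun z => L (fun n => ip (x n) z))).
  move=> k u v; rewrite addrC -(mean_lin _ mL); try exact: sq_bounded_ip.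
  by congr (L _); apply/funext => n; rewrite !(ipE ipH) addrC.
have [M hM] := bx; exists M => z; rewrite -[leRHS](mean_cst _ mL).
apply: (mean_le _ mL) => [||n]; first exact: sq_bounded_ip.
  by exists `|M + q z|.
have := ip_le ipH (x n) z; have := hM n.
by have := ip_ge0 ipH (x n); have := ip_ge0 ipH z; lra.
Qed.

(** Expanding the square around [p], the cross term with [x n - p] has mean zero. *)
Lemma weak_center_dist p z : weak_center L x p ->
  L (fun n => q (x n - z)) = L (fun n => q (x n - p)) + q (z - p).
Proof.
move=> hp.
have -> : (fun n => q (x n - z)) = (fun n => q (x n - p) +
    2 * (ip (x n) (p - z) + 1 * (2^-1 * (q z - q p)))).
  apply/funext => n; rewrite !(ipE ipH) (ipC ipH p (x n)) (ipC ipH z (x n)).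
  by lra.
have bc : bounded_seq (fun _ : nat => 2^-1 * (q z - q p)).
  by eexists => n.
have bi := sq_bounded_ip (p - z) bx.
have bb : bounded_seq (fun n => ip (x n) (p - z) + 1 * (2^-1 * (q z - q p))).
  have bc' : bounded_seq (fun _ : nat => - (2^-1 * (q z - q p))) by eexists => n.
  have := bounded_seqB bi bc'.
  by under [X in bounded_seq X -> _]funext => n do rewrite opprK -[_^-1 * _]mul1r.
rewrite (mean_lin _ mL)//; last exact: sq_bounded_dist.
rewrite (mean_lin _ mL)// (mean_cst _ mL) hp !(ipE ipH) (ipC ipH z p); lra.
Qed.

(** With [c] the projection of [p] onto [D], every [x n] satisfies
    [ip (x n) (p - c) <= ip c (p - c)]. Taking means replaces [x n] by [p], so [q (p - c) <= 0]. *)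
Lemma weak_center_mem (D : set V) p : weak_center L x p ->
  sq_closed (ip := ip) D -> segment_closed D -> (forall n, D (x n)) -> D p.
Proof.
move=> hp clD cvD Dx.
have [|c Dc hc] := variational_inequality ipH _ clD cvD
  (scalar_ip ipH p) (bounded_form_ip ipH p).
  by exists (x 0%N).
suff /(ip_eq0 ipH)/eqP : q (p - c) = 0 by rewrite subr_eq0 => /eqP ->.
apply/le_anti/andP; split; last exact: ip_ge0 ipH _.
have : L (fun n => ip (x n) (p - c)) <= L (fun=> ip c (p - c)).
  apply: (mean_le _ mL) => [||n]; [exact: sq_bounded_ip|by eexists => n|].
  have := hc _ (Dx n); rewrite !(ipE ipH) (ipC ipH p (x n)) (ipC ipH c (x n))
    (ipC ipH p c).
  by lra.
rewrite hp (mean_cst _ mL) !(ipE ipH); lra.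
Qed.

End Mean.
End Center.

(** * Krasnoselskii-Mann iteration *)

Section KrasnoselskiiMann.
Context {R : realType} {V : lmodType R} {ip : V -> V -> R}.
Hypothesis ipH : real_hilbert ip.
Local Set Implicit Arguments.
Local Unset Strict Implicit.
Local Notation q x := (ip x x).

Context {C : set V} {T : V -> V}.
Hypotheses (bC : exists M, forall z, C z -> q z <= M)
  (clC : sq_closed (ip := ip) C) (cvC : segment_closed C)
  (TC : forall z, C z -> C (T z))
  (Tne : forall u v, C u -> C v -> q (T u - T v) <= q (u - v)).

Lemma sq_bounded_in x : (forall n, C (x n)) -> sq_bounded (ip := ip) x.
Proof. by case: bC => M hM Cx; exists M => n; exact: hM. Qed.

Lemma sq_dist_eq0 u v : q (u - v) <= 0 -> u = v.
Proof.
move=> h; apply/eqP; rewrite -subr_eq0; apply/eqP/(ip_eq0 ipH).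
by apply/le_anti; rewrite h (ip_ge0 ipH).
Qed.

Lemma nonexpansive_fixed_point : C !=set0 -> exists2 p, C p & T p = p.
Proof.
move=> [c0 Cc0]; pose y n := iter n T c0.
have Cy n : C (y n) by elim: n => //= n; exact: TC.
have byd := sq_bounded_in Cy.
have [L mL Lshift] := @shift_invariant_mean R.
have [p hp] := weak_center_exists ipH mL byd.
have Cp := weak_center_mem ipH mL byd hp clC cvC Cy.
exists p => //; apply: sq_dist_eq0.
have bd z := sq_bounded_dist ipH z byd.
have := weak_center_dist ipH mL byd (T p) hp.
have : L (fun n => q (y n - T p)) <= L (fun n => q (y n - p)).
  (* Shift invariance replaces [y n] by [y n.+1], that is [T (y n)], so nonexpansiveness applies
     termwise. *)
  rewrite -(Lshift _ (bd (T p))); apply: (mean_le _ mL) => [||n] //.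
  - by have [M hM] := bd (T p); exists M => n; exact: hM n.+1.
  - exact: (Tne (Cy n) Cp).
by lra.
Qed.

(** * The averaged iteration and its weak limit *)

Section Iteration.
Context {lambda : R} {x : nat -> V}.
Hypotheses (l01 : 0 < lambda < 1) (Cx0 : C (x 0%N))
  (xS : forall n, x n.+1 = (1 - lambda) *: x n + lambda *: T (x n)).

Lemma iteration_mem n : C (x n).
Proof.
elim: n => // n IH; rewrite xS; apply: cvC => //; last exact: TC.
by case/andP: l01 => /ltW-> /ltW->.
Qed.

Let bx := sq_bounded_in iteration_mem.

(** Uses [q ((1 - t) *: u + t *: v) = (1 - t) * q u + t * q v - t * (1 - t) * q (u - v)] for
    [t = lambda], [u = x n - p], [v = T (x n) - p], where [q v <= q u]. *)
Lemma fejer_step p n : C p -> T p = p ->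
  q (x n.+1 - p) <= q (x n - p) - lambda * (1 - lambda) * q (x n - T (x n)).
Proof.
move=> Cp Tp; have := Tne (iteration_mem n) Cp; rewrite Tp xS.
case/andP: l01 => l0 l1.
rewrite !(ipE ipH) (ipC ipH p (x n)) (ipC ipH p (T (x n))) (ipC ipH (T (x n)) (x n)).
by nra.
Qed.

Lemma fejer_cvg p : C p -> T p = p ->
  exists d : R, q (x n - p) @[n --> \oo] --> d.
Proof.
move=> Cp Tp; eexists; apply: nonincreasing_cvgn.
  apply/nonincreasing_seqP => n; apply: (le_trans (fejer_step n Cp Tp)).
  case/andP: l01 => l0 l1; have := ip_ge0 ipH (x n - T (x n)).
  by have := mulr_gt0 l0 (_ : 0 < 1 - lambda); nra.
by exists 0 => _ [n _ <-]; exact: ip_ge0 ipH _.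
Qed.

(** Relative to a fixed point, [fejer_step] bounds the residual by a multiple of the decrement of a
    convergent sequence. *)
Lemma asymptotically_regular : q (x n - T (x n)) @[n --> \oo] --> (0 : R).
Proof.
have [p Cp Tp] : exists2 p, C p & T p = p.
  by apply: nonexpansive_fixed_point; exists (x 0%N).
have [d hd] := fejer_cvg Cp Tp.
case/andP: l01 => l0 l1.
have ll : 0 < lambda * (1 - lambda) by rewrite mulr_gt0// subr_gt0.
apply: (@squeeze_cvgr _ _ _ _ (fun=> 0)
  (fun n => (lambda * (1 - lambda))^-1 * (q (x n - p) - q (x n.+1 - p)))).
- apply: nearW => n; rewrite (ip_ge0 ipH)/= mulrC ler_pdivlMr// mulrC.
  by have := fejer_step n Cp Tp; lra.
- exact: cvg_cst.
- rewrite -[X in _ --> X](mulr0 (lambda * (1 - lambda))^-1) -(subrr d).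
  apply: cvgM; first exact: cvg_cst.
  by apply: cvgB => //; rewrite (cvg_shiftS (fun n => q (x n - p))).
Qed.

(* For s > 0, q (u + v) <= (1 + s^-1) q u + (1 + s) q v; with u = x n - T (x n)
   asymptotically negligible, letting s go to 0 gives q (x n - T p) <= q (x n - p)
   in the limit. *)
Lemma ultra_center_fixed U p : UltraFilter U -> \oo `<=` U ->
  weak_center (ip := ip) (fun a => lim (a n @[n --> U])) x p -> C p /\ T p = p.
Proof.
move=> UU ooU hp; have mL := ultra_mean (R := R) UU.
have Cp := weak_center_mem ipH mL bx hp clC cvC iteration_mem.
split=> //; apply: sq_dist_eq0.
set L := (fun a => lim _) in mL hp.
have L0 : L (fun n => q (x n - T (x n))) = 0.
  by apply: cvg_lim => // A hA; apply: ooU; exact: asymptotically_regular.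
have b0 : bounded_seq (fun n => q (x n - T (x n))).
  have [M hM] := bC; exists (2 * M + 2 * M) => n.
  have CT := TC (iteration_mem n).
  rewrite ger0_norm ?(ip_ge0 ipH)//.
  have := ip_ge0 ipH (x n + T (x n)); have := hM _ CT; have := hM _ (iteration_mem n).
  by rewrite !(ipE ipH) (ipC ipH (T (x n)) (x n)); lra.
have bd z := sq_bounded_dist ipH z bx.
have key s : 0 < s -> L (fun n => q (x n - T p)) <= (1 + s) * L (fun n => q (x n - p)).
  move=> s0.
  have bl k : bounded_seq (fun n => k * q (x n - p)).
    by have [M hM] := bd p; exists (`|k| * M) => n; rewrite normrM ler_wpM2l.
  have bz : bounded_seq (fun _ : nat => 0 : R) by exists 0 => n; rewrite normr0.
  (* The summand [0] gives the shape [a + k * b] that [mean_lin] expects. *)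
  have bs : bounded_seq (fun n => 0 + (1 + s) * q (x n - p)).
    by under [X in bounded_seq X]funext => n do rewrite add0r.
  have <- : L (fun n => (0 + (1 + s) * q (x n - p)) +
      (1 + s^-1) * q (x n - T (x n))) = (1 + s) * L (fun n => q (x n - p)).
    by rewrite (mean_lin _ mL)// (mean_lin _ mL)// (mean_cst _ mL) L0 mulr0 add0r addr0.
  apply: (mean_le _ mL) => // [|n].
    have [M hM] := bl (1 + s); have [N hN] := b0.
    exists (M + `|1 + s^-1| * N) => n; rewrite add0r (le_trans (ler_normD _ _))//.
    by rewrite lerD// normrM ler_wpM2l.
  have -> : x n - T p = (x n - T (x n)) + (T (x n) - T p) by rewrite addrA subrK.
  have := Tne (iteration_mem n) Cp.
  move: (x n - T (x n)) (T (x n) - T p) (q (x n - p)) => u v w hw.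
  (* Young's inequality: expand this square and divide by [s]. *)
  have := ip_ge0 ipH (u - s *: v); rewrite !(ipE ipH) (ipC ipH v u) => h.
  have : 2 * ip u v <= s^-1 * q u + s * q v.
    by rewrite -(ler_pM2l s0) mulrDr mulVKf ?gt_eqF//; lra.
  have : s * q v <= s * w by rewrite ler_pM2l.
  move: hw; move: (s^-1) (q u) (q v) (ip u v) => r a b c.
  by rewrite add0r !mulrDl !mul1r; lra.
have Lp0 : 0 <= L (fun n => q (x n - p)).
  rewrite -[leLHS](mean_cst _ mL); apply: (mean_le _ mL) => // [|n].
    by exists 0 => n; rewrite normr0.
  exact: ip_ge0 ipH _.
have : L (fun n => q (x n - T p)) <= L (fun n => q (x n - p)).
  apply/ler_addgt0Pr => e e0.
  (* With this value of [s] the excess in [key] is at most [e]; the [+ 1] keeps the denominator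
     positive. *)
  have e1 : 0 < e / (L (fun n => q (x n - p)) + 1) by rewrite divr_gt0//; lra.
  apply: (le_trans (key _ e1)); rewrite mulrDl mul1r lerD2l mulrAC ler_pdivrMr; nra.
by rewrite (weak_center_dist ipH mL bx (T p) hp); lra.
Qed.

(* The limits d, d' of q (x n - p) and q (x n - p') exist along \oo, so the two
   centre identities give d' = d + q (p' - p) and d = d' + q (p - p'). *)
Lemma ultra_center_unique U U' p p' : UltraFilter U -> \oo `<=` U ->
  UltraFilter U' -> \oo `<=` U' ->
  weak_center (ip := ip) (fun a => lim (a n @[n --> U])) x p ->
  weak_center (ip := ip) (fun a => lim (a n @[n --> U'])) x p' -> p = p'.
Proof.
move=> UU ooU UU' ooU' hp hp'.
have [Cp Tp] := ultra_center_fixed UU ooU hp.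
have [Cp' Tp'] := ultra_center_fixed UU' ooU' hp'.
have [d hd] := fejer_cvg Cp Tp; have [d' hd'] := fejer_cvg Cp' Tp'.
have limE (W : set_system nat) z (c : R) : UltraFilter W -> \oo `<=` W ->
    q (x n - z) @[n --> \oo] --> c -> lim (q (x n - z) @[n --> W]) = c.
  by move=> WW ooW hc; apply: cvg_lim => // A hA; apply: ooW; exact: hc.
apply: sq_dist_eq0.
have := weak_center_dist ipH (ultra_mean (R := R) UU) bx p' hp.
have := weak_center_dist ipH (ultra_mean (R := R) UU') bx p hp'.
rewrite (limE _ _ _ UU ooU hd) (limE _ _ _ UU' ooU' hd).
rewrite (limE _ _ _ UU ooU hd') (limE _ _ _ UU' ooU' hd').
have := ip_ge0 ipH (p' - p); lra.
Qed.

Lemma krasnoselskii_mann : exists2 p, C p /\ T p = p &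
  forall l : V -> R, scalar l -> bounded_form (ip := ip) l ->
    l (x n) @[n --> \oo] --> l p.
Proof.
have [U [UU ooU]] := @ultraFilterLemma _ (\oo : set_system nat) _.
have [p hp] := weak_center_exists ipH (ultra_mean (R := R) UU) bx.
exists p; first exact: ultra_center_fixed UU ooU hp.
move=> l sl bl; have [z hz] := riesz_representation ipH sl bl.
apply: cvg_ultra => W WW ooW.
have [p' hp'] := weak_center_exists ipH (ultra_mean (R := R) WW) bx.
have pE := ultra_center_unique UU ooU WW ooW hp hp'.
(* The centre property identifies [l p] with the value of [lim] along [W]; boundedness then makes
   this an actual convergence. *)
have := hp' z; rewrite -pE hz (ipC ipH z) => <-.
under [X in X @ _]funext => n do rewrite hz (ipC ipH z).
exact: (ultra_cvg WW (sq_bounded_ip ipH z bx)).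
Qed.

End Iteration.
End KrasnoselskiiMann.

(** * Restriction of scalars to R *)

Section ScalarField.
Context {R : realType}.
Local Set Implicit Arguments.
Local Unset Strict Implicit.

(** With [scalar_re] and [scalar_im], this interface confines the case split on [k] to the short
    lemmas below. *)
Definition scalar_emb k : R -> scalar_field R k :=
  match k with RealScalars => idfun | ComplexScalars => fun a => a%:C%C end.

Definition scalar_re k : scalar_field R k -> R :=
  match k with RealScalars => idfun | ComplexScalars => @complex.Re R end.

Definition scalar_im k : scalar_field R k -> R :=
  match k with RealScalars => fun=> 0 | ComplexScalars => @complex.Im R end.

Context {k : scalar_kind}.
Local Notation K := (scalar_field R k).
Local Notation emb := (@scalar_emb k).
Local Notation re := (@scalar_re k).
Local Notation im := (@scalar_im k).

Lemma scalar_embD a b : emb (a + b) = emb a + emb b.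
Proof. by case: k => //=; rewrite rmorphD. Qed.

Lemma scalar_embB a b : emb (a - b) = emb a - emb b.
Proof. by case: k => //=; rewrite rmorphB. Qed.

Lemma scalar_embM a b : emb (a * b) = emb a * emb b.
Proof. by case: k => //=; rewrite rmorphM. Qed.

Lemma scalar_emb1 : emb 1 = 1.
Proof. by case: k => //=; rewrite rmorph1. Qed.

Lemma scalar_emb0 : emb 0 = 0.
Proof. by case: k => //=; rewrite rmorph0. Qed.

Lemma scalar_emb_le a b : (emb a <= emb b) = (a <= b).
Proof. by case: k => //=; rewrite complex.lecR. Qed.

Lemma scalar_emb_lt a b : (emb a < emb b) = (a < b).
Proof. by case: k => //=; rewrite complex.ltcR. Qed.

Lemma scalar_reD (x y : K) : re (x + y) = re x + re y.
Proof. by case: k x y => //= -[? ?] [? ?]. Qed.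

Lemma scalar_imD (x y : K) : im (x + y) = im x + im y.
Proof. by case: k x y => [? ?|[? ?] [? ?]] //=; rewrite addr0. Qed.

Lemma scalar_reB (x y : K) : re (x - y) = re x - re y.
Proof. by apply/eqP; rewrite -subr_eq opprK -scalar_reD subrK. Qed.

Lemma scalar_imB (x y : K) : im (x - y) = im x - im y.
Proof. by apply/eqP; rewrite -subr_eq opprK -scalar_imD subrK. Qed.

Lemma scalar_reZ a (x : K) : re (emb a * x) = a * re x.
Proof. by case: k x => //= -[? ?] /=; rewrite mul0r subr0. Qed.

Lemma scalar_imZ a (x : K) : im (emb a * x) = a * im x.
Proof. by case: k x => [?|[? ?]] /=; rewrite ?mulr0// mul0r addr0. Qed.

Lemma scalar_re_conj (x : K) : re (scalar_conj x) = re x.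
Proof. by case: k x => //= -[? ?]. Qed.

Lemma scalar_re_emb a : re (emb a) = a.
Proof. by case: k. Qed.

(** In the order of [R[i]], nonnegativity forces a zero imaginary part. *)
Lemma scalar_emb_re (x : K) : 0 <= x -> emb (re x) = x.
Proof. by case: k x => //= -[a b]; rewrite complex.lecE/= => /andP[/eqP-> _]. Qed.

Lemma scalar_re_norm (x : K) : emb `|re x| <= `|x|.
Proof. by case: k x => //= x; exact: complex.normc_ge_Re. Qed.

Lemma scalar_im_norm (x : K) : emb `|im x| <= `|x|.
Proof.
case: k x => [x|[a b]] /=; first by rewrite normr0.
rewrite complex.normc_def complex.lecR /= -sqrtr_sqr ler_wsqrtr//.
by rewrite lerDr sqr_ge0.
Qed.

Lemma scalar_norm_le (x : K) : `|x| <= emb (`|re x| + `|im x|).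
Proof.
case: k x => [x|[a b]] /=; first by rewrite normr0 addr0.
rewrite complex.normc_def complex.lecR /= -[leRHS]ger0_norm ?addr_ge0//.
rewrite -sqrtr_sqr ler_wsqrtr// sqrrD !real_normK ?num_real//.
by rewrite -addrA addrCA [leRHS]addrC lerDl mulrn_wge0// mulr_ge0.
Qed.

End ScalarField.

(** A type synonym, so that the module structure over [R] does not compete with the original one on
    [H]. *)
Definition realified {R : realType} {k : scalar_kind}
  (H : lmodType (scalar_field R k)) : Type := H.

Section Realified.
Context {R : realType} {k : scalar_kind} (H : lmodType (scalar_field R k)).

HB.instance Definition _ := GRing.Zmodule.on (realified H).

Let rscale (a : R) (x : realified H) : realified H := (scalar_emb k a *: (x : H)).

Let rscaleA a b v : rscale a (rscale b v) = rscale (a * b) v.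
Proof. by rewrite /rscale scalerA scalar_embM. Qed.

Let rscale1 : left_id 1 rscale.
Proof. by move=> v; rewrite /rscale scalar_emb1 scale1r. Qed.

Let rscaleDr : right_distributive rscale +%R.
Proof. by move=> a u v; rewrite /rscale scalerDr. Qed.

Let rscaleDl v : {morph rscale^~ v : a b / a + b}.
Proof. by move=> a b; rewrite /rscale scalar_embD scalerDl. Qed.

HB.instance Definition _ := GRing.Zmodule_isLmodule.Build R (realified H)
  rscaleA rscale1 rscaleDr rscaleDl.

Lemma realified_scaleE (a : R) (x : realified H) :
  a *: x = (scalar_emb k a *: (x : H)) :> H.
Proof. by []. Qed.

End Realified.

(** * The given Hilbert space as a real one *)

Section HilbertBridge.
Context {R : realType} {k : scalar_kind}.
Context {H : completeNormedModType (scalar_field R k)}.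
Context {dot : {dot H for @scalar_conj R k}}.
Hypothesis dotN : norm_from_dot dot.
Local Set Implicit Arguments.
Local Unset Strict Implicit.

Local Notation K := (scalar_field R k).
Local Notation emb := (@scalar_emb R k).
Local Notation re := (@scalar_re R k).
Local Notation im := (@scalar_im R k).

Definition real_dot (x y : realified H) : R := re (dot x y).

Lemma real_dot_sqE (x : H) : emb (real_dot x x) = `|x| ^+ 2.
Proof. by rewrite dotN scalar_emb_re// -dotN exprn_ge0. Qed.

Lemma real_dot_ge0 (x : H) : 0 <= real_dot x x.
Proof. by rewrite -(scalar_emb_le (k := k)) real_dot_sqE scalar_emb0 exprn_ge0. Qed.

Lemma real_dot_lt (x : H) e : 0 <= e -> (real_dot x x < e ^+ 2) = (`|x| < emb e).
Proof.
move=> e0; rewrite -(scalar_emb_lt (k := k)) real_dot_sqE expr2 scalar_embM -expr2.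
by rewrite ltr_sqr// nnegrE// -(scalar_emb0 (k := k)) scalar_emb_le.
Qed.

Lemma real_dot_le (x y : H) : (real_dot x x <= real_dot y y) = (`|x| <= `|y|).
Proof.
by rewrite -(scalar_emb_le (k := k)) !real_dot_sqE ler_sqr ?nnegrE.
Qed.

Lemma cvg_real_dot (u : nat -> H) (p : H) :
  u n @[n --> \oo] --> p <->
  (fun n => real_dot (u n - p) (u n - p)) @ \oo --> (0 : R).
Proof.
split=> h; apply/cvgrPdist_lt => e e0.
  have se : 0 < emb (Num.sqrt e).
    by rewrite -(scalar_emb0 (k := k)) scalar_emb_lt sqrtr_gt0.
  move/cvgrPdist_lt : h => /(_ _ se); apply: filterS => n.
  rewrite distrC -real_dot_lt ?sqrtr_ge0// sqr_sqrtr ?ltW// => h.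
  by rewrite sub0r normrN ger0_norm// real_dot_ge0.
have eE := scalar_emb_re (ltW e0).
have r0 : 0 < re e by rewrite -(scalar_emb_lt (k := k)) scalar_emb0 eE.
have r2 : 0 < re e ^+ 2 by rewrite exprn_gt0.
move/cvgrPdist_lt : h => /(_ _ r2); apply: filterS => n.
by rewrite sub0r normrN ger0_norm ?real_dot_ge0// real_dot_lt ?ltW// eE distrC.
Qed.

Lemma real_dot_hilbert : real_hilbert real_dot.
Proof.
split.
- move=> x y; rewrite /real_dot (@hermitian_subproof _ _ _ _ dot x y).
  by rewrite expr0 mul1r scalar_re_conj.
- by move=> x y z; rewrite /real_dot linearDl scalar_reD.
- by move=> a x z; rewrite /real_dot linearZl_LR scalar_reZ.
- exact: real_dot_ge0.
- move=> x x0; apply/eqP; rewrite -normr_eq0 -sqrf_eq0.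
  by rewrite -(real_dot_sqE x) x0 scalar_emb0.
(* Retyping [u] in [H] gives access to the norm topology and its completeness. *)
- move=> u hu; pose v : nat -> H := u.
  suff /cvg_ex[p hp] : cvg (v n @[n --> \oo]).
    by exists p; apply/cvg_real_dot.
  apply/cauchy_cvgP/cauchy_exP => e e0.
  have eE := scalar_emb_re (ltW e0).
  have r0 : 0 < re e by rewrite -(scalar_emb_lt (k := k)) scalar_emb0 eE.
  have [N hN] := hu _ (exprn_gt0 2 r0).
  exists (v N); exists N => // n Nn; rewrite /= -ball_normE /= -eE -real_dot_lt ?ltW//.
  exact: hN.
Qed.

Lemma real_dot_segment_closed (C : set H) :
  @convex_set K H C -> segment_closed (C : set (realified H)).
Proof.
move=> cC t u v /andP[t0 t1] Cu Cv.
(* [conv] puts its parameter on the first point, hence [1 - t]. *)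
have e0 : 0 <= emb (1 - t) by rewrite -(scalar_emb0 (k := k)) scalar_emb_le subr_ge0.
have e1 : emb (1 - t) <= 1 by rewrite -(scalar_emb1 (k := k)) scalar_emb_le gerBl.
have tE : 1 - emb (1 - t) = emb t.
  by rewrite -(scalar_emb1 (k := k)) -scalar_embB opprB addrC subrK.
have := cC u v (Itv01 e0 e1); rewrite !inE => /(_ Cu Cv).
suff -> : (1 - t) *: u + t *: v = conv (Itv01 e0 e1) (u : convex_lmodType H) v by [].
by rewrite !realified_scaleE -tE.
Qed.

(** Continuity gives [|g (f z)| <= M * |z|], and this product is at most [M ^+ 2 + |z| ^+ 2]. The
    map [g] is meant to be [scalar_re] or [scalar_im]. *)
Lemma real_dot_bounded_form (f : {linear H -> K^o}) (g : K -> R) :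
  (forall z, emb `|g z| <= `|z|) -> continuous f ->
  bounded_form (ip := real_dot) (fun z => g (f z)).
Proof.
move=> hg /linear_bounded_continuous/linear_boundedP/pinfty_ex_gt0[M M0 hM].
have ME := scalar_emb_re (ltW M0).
exists (re M ^+ 2) => z.
have zE := scalar_emb_re (normr_ge0 (z : H)).
have : real_dot z z = re `|(z : H)| ^+ 2.
  by rewrite -[LHS](scalar_re_emb (k := k)) real_dot_sqE -{1}zE !expr2
    -scalar_embM scalar_re_emb.
have : `|g (f z)| <= re M * re `|(z : H)|.
  by rewrite -(scalar_emb_le (k := k)) scalar_embM ME zE (le_trans (hg _)).
move: (re M) (re `|(z : H)|) => a b hab ->.
by apply: (le_trans (ler_norm _)); apply: (le_trans hab); nra.
Qed.

End HilbertBridge.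

(** * Transfer of the real result to the original scalars *)

Theorem theorem6 (R : realType) (k : scalar_kind)
    (H : completeNormedModType (scalar_field R k))
    (dot : {dot H for @scalar_conj R k}) (C : set H) (F : H * H -> H)
    (lambda : scalar_field R k) (x0 : H) (x : nat -> H) :
  norm_from_dot dot ->
  C !=set0 -> bounded_set C -> closed C -> @convex_set (scalar_field R k) H C ->
  set_fun (C `*` C) C F ->
  weakly_nonexpansive C F ->
  0 < lambda < 1 ->
  C x0 ->
  x 0%N = x0 ->
  (forall n : nat,
     x n.+1 = (1 - lambda) *: x n + lambda *: F (x n, x n)) ->
  exists2 p : H, coupled_fixed_point C F p p & weakly_cvg x p.
Proof.
move=> dotN _ bC clC cC FC [a [b [a0 b0 ab Fne]]] /andP[l0 l1] Cx0 x0E xS.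
have ipH := real_dot_hilbert dotN.
have lE := scalar_emb_re (ltW l0).
have TC z : C z -> C (F (z, z)) by move=> Cz; apply: FC.
have bq : exists M, forall z, C z -> real_dot (dot := dot) z z <= M.
  have [M M0 hM] := ex_strict_bound_gt0 bC.
  exists (scalar_re M ^+ 2) => z Cz; apply/ltW; rewrite real_dot_lt//.
    by rewrite scalar_emb_re ?ltW//; exact: hM.
  by rewrite -(scalar_emb_le (k := k)) scalar_emb0 scalar_emb_re ltW.
have clq : sq_closed (ip := real_dot (dot := dot)) (C : set (realified H)).
  move=> u p Cu /(cvg_real_dot dotN) up.
  by apply: (closed_cvg C clC _ p up); exact: nearW.
have Tne u v : C u -> C v ->
    real_dot (dot := dot) (F (u, u) - F (v, v) : H) (F (u, u) - F (v, v) : H) <=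
    real_dot (dot := dot) (u - v : H) (u - v : H).
  move=> Cu Cv; rewrite real_dot_le//.
  apply: (le_trans (Fne _ _ _ _ Cu Cu Cv Cv)).
  (* On the diagonal both displacements are [u - v], so the constants add up to [a + b <= 1]. *)
  by rewrite -mulrDl ler_piMl.
have l01 : 0 < scalar_re lambda < 1.
  by rewrite -!(scalar_emb_lt (k := k)) scalar_emb0 scalar_emb1 lE l0 l1.
have [||p [Cp Tp] wp] := krasnoselskii_mann (x := x : nat -> realified H) ipH
  bq clq (real_dot_segment_closed cC) TC Tne l01.
- by rewrite x0E.
- by move=> n; rewrite xS !realified_scaleE scalar_embB scalar_emb1 lE.
exists p => // f cf.
(* [wp] only concerns real forms, so [f] is split into real and imaginary parts, each controlled up
   to half of [e]. *)
have reP : scalar_re (f (x n)) @[n --> \oo] --> scalar_re (f p).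
  apply: (wp (fun z => scalar_re (f z))).
    by move=> c u v; rewrite linearD realified_scaleE linearZ scalar_reD scalar_reZ.
  by apply: real_dot_bounded_form => // z; exact: scalar_re_norm.
have imP : scalar_im (f (x n)) @[n --> \oo] --> scalar_im (f p).
  apply: (wp (fun z => scalar_im (f z))).
    by move=> c u v; rewrite linearD realified_scaleE linearZ scalar_imD scalar_imZ.
  by apply: real_dot_bounded_form => // z; exact: scalar_im_norm.
apply/cvgrPdist_lt => e e0.
have eE := scalar_emb_re (ltW e0).
have r2 : 0 < scalar_re e / 2.
  by rewrite divr_gt0// -(scalar_emb_lt (k := k)) scalar_emb0 eE.
move/cvgrPdist_lt : reP => /(_ _ r2) hre; move/cvgrPdist_lt : imP => /(_ _ r2).
apply: filterS2 hre => n hre him.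
apply: (le_lt_trans (scalar_norm_le _)).
rewrite -eE scalar_emb_lt scalar_reB scalar_imB; lra.
Qed.
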